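(* Let $S=\{x\in\mathbb{R}^n : g(x)=0\}$ and $f$ satisfy the standing assumptions given in the context. If the problem $\min_{x\in S} f(x)$ is nondegenerate, then it satisfies the tangent Error Bound condition with some constant $\mu>0$, i.e. there exists $\mu>0$ such that $$\mu\,\rho(x,\Omega)\le \|P_{T_x}f'(x)\|\qquad\text{for all } x\in S .$$
   Context: Setting and standing assumptions. $\mathbb{R}^n$ is Euclidean with norm $\|\cdot\|$; matrix norms are operator norms; $\rho(x,Q)=\inf_{y\in Q}\|x-y\|$. Let $m<n$, $f:\mathbb{R}^n\to\mathbb{R}$ and $g=(g_1,\dots,g_m):\mathbb{R}^n\to\mathbb{R}^m$ be twice continuously differentiable with Lipschitz continuous second derivatives $f'',g_i''$; $f$ is Lipschitz with constant $L_0$ and its gradient $f'$ (a column vector) is Lipschitz with constant $L_1$. The set $S=\{x: g(x)=0\}$ is nonempty and compact, is a manifold without boundary, the Jacobi matrix $g'(x)\in\mathbb{R}^{m\times n}$ has rank $m$ at every $x\in S$, and $S$ is proximally smooth with some constant $R>0$ (i.e. the distance function $\rho(\cdot,S)$ is continuously differentiable on $\{x: 0<\rho(x,S)<R\}$). Notation. For $x\in S$, $T_x=\{v\in\mathbb{R}^n: g'(x)v=0\}$ is the tangent subspace and $P_{T_x}=I_n-g'(x)^T(g'(x)g'(x)^T)^{-1}g'(x)$ is the orthogonal projector onto it. The set of stationary points is $\Omega=\{x\in S: P_{T_x}f'(x)=0\}$. For $x\in S$ put $\lambda_x=-(g'(x)g'(x)^T)^{-1}g'(x)f'(x)\in\mathbb{R}^m$.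 For $z=[x,\lambda]\in\mathbb{R}^{n+m}$ let $$F(z)=\begin{bmatrix} f'(x)+g'(x)^T\lambda\\ g(x)\end{bmatrix},\qquad F'(z)=\begin{bmatrix} f''(x)+\sum_{i=1}^m\lambda_i g_i''(x) & g'(x)^T\\ g'(x)&0\end{bmatrix},$$ and $F'(x,\lambda_x)$ denotes $F'(z)$ evaluated at $z=[x,\lambda_x]$. Nondegeneracy. The problem $\min_{x\in S}f(x)$ is called nondegenerate if for all $x_*\in\Omega$ the matrix $F'(x_*,\lambda_{x_*})$ is invertible, and there is $\sigma_0>0$ with $\|F'(x_*,\lambda_{x_*})^{-1}\|\le\sigma_0$ for all $x_*\in\Omega$. *)

(* Defs.v *)
From HB Require Import structures.
From mathcomp Require Import all_boot all_order all_algebra.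
From mathcomp Require Import all_classical all_reals all_analysis.

Set Implicit Arguments.
Unset Strict Implicit.
Unset Printing Implicit Defensive.

Import Order.TTheory GRing.Theory Num.Theory.
Import numFieldNormedType.Exports.

Local Open Scope classical_set_scope.
Local Open Scope ring_scope.

(* The library norm `|.| on 'cV[R]_n is the sup norm.  It is used here only
   through the topology and the derivatives it induces, which are the Euclidean
   ones; every quantitative statement uses [enorm], [opnorm] and [edist_to]. *)

Section EuclideanSpace.
Context {R : realType}.

Definition enorm {n : nat} (x : 'cV[R]_n) : R :=
  Num.sqrt (\sum_(i < n) x i 0 ^+ 2).

Definition opnorm {p q : nat} (A : 'M[R]_(p, q)) : R :=
  sup [set enorm (A *m x) | x in [set x : 'cV[R]_q | enorm x <= 1]].

(* Meaningful for nonempty Q; the library sets inf set0 = 0. *)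
Definition edist_to {n : nat} (Q : set 'cV[R]_n) (x : 'cV[R]_n) : R :=
  inf [set enorm (x - y) | y in Q].

Definition elipschitz {n : nat} {W : zmodType} (normW : W -> R) (L : R)
    (h : 'cV[R]_n -> W) : Prop :=
  forall x y, normW (h x - h y) <= L * enorm (x - y).

End EuclideanSpace.

Section Derivatives.
Context {R : realType} {n : nat}.

Definition grad (f : 'cV[R]_n -> R) (x : 'cV[R]_n) : 'cV[R]_n :=
  \col_(j < n) 'D_(delta_mx j 0) f x.

Definition jac {m : nat} (g : 'cV[R]_n -> 'cV[R]_m) (x : 'cV[R]_n) :
    'M[R]_(m, n) :=
  \matrix_(i < m, j < n) 'D_(delta_mx j 0) (fun y => g y i 0) x.

Definition hess (f : 'cV[R]_n -> R) (x : 'cV[R]_n) : 'M[R]_n :=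
  jac (grad f) x.

Definition coordf {m : nat} (g : 'cV[R]_n -> 'cV[R]_m) (i : 'I_m) :
    'cV[R]_n -> R :=
  fun x => g x i 0.

Definition twice_cont_differentiable (f : 'cV[R]_n -> R) : Prop :=
  [/\ forall x, differentiable f x,
      forall x, differentiable (grad f) x
    & continuous (hess f)].

Definition proximally_smooth (Q : set 'cV[R]_n) (r : R) : Prop :=
  forall x, 0 < edist_to Q x < r ->
    differentiable (edist_to Q) x /\ {for x, continuous (grad (edist_to Q))}.

(* Topological manifold without boundary, of dimension d, in the topology
   induced by R^n: phi and psi are mutually inverse homeomorphisms between a
   relatively open neighbourhood Q `&` U of x and an open subset V of R^d. *)
Definition manifold_without_boundary (d : nat) (Q : set 'cV[R]_n) : Prop :=
  forall x, Q x ->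
  exists (U : set 'cV[R]_n) (V : set 'cV[R]_d)
         (phi : 'cV[R]_n -> 'cV[R]_d) (psi : 'cV[R]_d -> 'cV[R]_n),
  [/\ open U /\ U x,
      open V,
      {within Q `&` U, continuous phi} /\ {within V, continuous psi},
      forall y, (Q `&` U) y -> V (phi y) /\ psi (phi y) = y
    & forall v, V v -> (Q `&` U) (psi v) /\ phi (psi v) = v].

End Derivatives.

Section ConstrainedProblem.
Context {R : realType} {n m : nat}.
Variables (f : 'cV[R]_n -> R) (g : 'cV[R]_n -> 'cV[R]_m).

Definition feasible : set 'cV[R]_n := [set x | g x = 0].

(* invmx is the true inverse where jac g x has rank m, in particular on
   [feasible] under the rank hypothesis; same remark for [multiplier]. *)
Definition tangent_proj (x : 'cV[R]_n) : 'M[R]_n :=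
  1%:M - (jac g x)^T *m invmx (jac g x *m (jac g x)^T) *m jac g x.

Definition stationary : set 'cV[R]_n :=
  [set x | feasible x /\ tangent_proj x *m grad f x = 0].

Definition multiplier (x : 'cV[R]_n) : 'cV[R]_m :=
  - (invmx (jac g x *m (jac g x)^T) *m jac g x *m grad f x).

(* Jacobi matrix, at [x, l], of the map
   [x, l] |-> [grad f x + (jac g x)^T *m l, g x]. *)
Definition lagrange_jac (x : 'cV[R]_n) (l : 'cV[R]_m) : 'M[R]_(n + m) :=
  block_mx (hess f x + \sum_(i < m) l i 0 *: hess (coordf g i) x) (jac g x)^T
           (jac g x) 0.

Definition nondegenerate_problem : Prop :=
  (forall x, stationary x -> lagrange_jac x (multiplier x) \in unitmx) /\
  exists2 sigma0 : R, 0 < sigma0 &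
    forall x, stationary x ->
      opnorm (invmx (lagrange_jac x (multiplier x))) <= sigma0.

End ConstrainedProblem.

(* Main.v *)
Require Import Defs.
From mathcomp Require Import all_boot all_order all_algebra.
From mathcomp Require Import all_classical all_reals all_analysis.
From mathcomp Require Import lra.
Import Order.TTheory GRing.Theory Num.Theory.
Import numFieldNormedType.Exports.
Local Open Scope classical_set_scope.
Local Open Scope ring_scope.

(** Write phi x = P_{T_x} f'(x) = f'(x) + g'(x)^T l_x, where l_x is the
    multiplier.  At a stationary x0, put u = x - x0 and w = l_x - l_x0.
    Linearizing f' + g'^T l_x0 and g at x0 gives, for x in S,
      [f'' + sum_i l_x0,i g_i'', g'(x)^T; g'(x0), 0] [u; w]
        = [phi x + o(u); o(u)],
    and the matrix tends to the invertible F'(x0, l_x0), so that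
    |u| <= c |phi x| near x0; no smallness of w is needed because g'(x)^T,
    rather than g'(x0)^T, multiplies w.  At a nonstationary x0, |phi| is bounded
    away from 0 by continuity while the distance to the stationary set is
    bounded.  Compactness of S makes these local constants uniform. *)

(** * Sup norm of matrices and its comparison with the Euclidean norm *)

Lemma le_mx_entry {R : realType} {p q} (A : 'M[R]_(p, q)) i j :
  `|A i j| <= `|A|.
Proof.
rewrite [leRHS]mx_normrE.
exact: (le_bigmax _ (fun ij : 'I_p * 'I_q => `|A ij.1 ij.2|) (i, j)).
Qed.

Lemma mx_norm_le {R : realType} {p q} (A : 'M[R]_(p, q)) c :
  0 <= c -> (forall i j, `|A i j| <= c) -> `|A| <= c.
Proof.
move=> c0 Ac; rewrite [leLHS]mx_normrE.
by apply: bigmax_le => // ij _; exact: Ac.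
Qed.

Lemma mx_norm_mulmx {R : realType} {p q s}
    (A : 'M[R]_(p, q)) (B : 'M[R]_(q, s)) :
  `|A *m B| <= q%:R * `|A| * `|B|.
Proof.
apply: mx_norm_le => [|i j]; first by rewrite !mulr_ge0.
rewrite mxE (le_trans (ler_norm_sum _ _ _))//.
rewrite -mulrA mulr_natl -[X in _ *+ X](card_ord q) -sumr_const.
by apply: ler_sum => k _; rewrite normrM ler_pM// le_mx_entry.
Qed.

Lemma enorm_ge_norm {R : realType} {n} (v : 'cV[R]_n) : `|v| <= enorm v.
Proof.
apply: mx_norm_le => [|i j]; first exact: sqrtr_ge0.
rewrite (ord1 j) -sqrtr_sqr ler_wsqrtr// (bigD1 i)//= lerDl.
by apply: sumr_ge0 => k _; exact: sqr_ge0.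
Qed.

Lemma enorm_le_norm {R : realType} {n} (v : 'cV[R]_n) : enorm v <= n%:R * `|v|.
Proof.
have nv0 : 0 <= n%:R * `|v| by rewrite mulr_ge0.
rewrite -(ler_pXn2r (n := 2))// ?nnegrE ?sqrtr_ge0//.
rewrite sqr_sqrtr; last by apply: sumr_ge0 => i _; exact: sqr_ge0.
apply: (@le_trans _ _ (\sum_(i < n) `|v| ^+ 2)).
  apply: ler_sum => i _; rewrite -[v i 0 ^+ 2]real_normK ?num_real//.
  by rewrite ler_pXn2r// ?nnegrE// le_mx_entry.
rewrite sumr_const card_ord -[leLHS]mulr_natl exprMn ler_wpM2r ?sqr_ge0//.
(* The crude inequality [n <= n ^ 2] gives the factor [n] in place of its square root. *)
by rewrite -natrX ler_nat; case: (n) => // k; rewrite leq_pmull.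
Qed.

(** * Limits of matrix-valued maps and stability of invertibility *)

Lemma cvg_mx {R : realType} {T : Type} {p q}
    (F : set_system T) {FF : Filter F}
    (M : T -> 'M[R]_(p, q)) (M0 : 'M[R]_(p, q)) :
  (forall i j, M x i j @[x --> F] --> M0 i j) -> M x @[x --> F] --> M0.
Proof.
move=> cM; apply/cvgrPdist_le => e e0.
have : \forall x \near F, forall i j, `|M0 i j - M x i j| <= e.
  apply: filter_forall => i; apply: filter_forall => j.
  by move/cvgrPdist_le : (cM i j); exact.
apply: filterS => x Mx; apply: mx_norm_le => [|i j]; first exact: ltW.
by rewrite !mxE.
Qed.

Lemma cvg_mx_entry {R : realType} {T : Type} {p q}
    (F : set_system T) {FF : Filter F}
    (M : T -> 'M[R]_(p, q)) (M0 : 'M[R]_(p, q)) i j :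
  M x @[x --> F] --> M0 -> M x i j @[x --> F] --> M0 i j.
Proof.
by move=> cM; exact: (cvg_comp _ _ cM (@coord_continuous R p q i j M0)).
Qed.

Lemma cvg_mulmx {R : realType} {T : Type} {p q s}
    (F : set_system T) {FF : Filter F}
    (A : T -> 'M[R]_(p, q)) (B : T -> 'M[R]_(q, s))
    (A0 : 'M[R]_(p, q)) (B0 : 'M[R]_(q, s)) :
  A x @[x --> F] --> A0 -> B x @[x --> F] --> B0 ->
  A x *m B x @[x --> F] --> A0 *m B0.
Proof.
move=> cA cB; apply: cvg_mx => i j.
under eq_fun do rewrite mxE.
rewrite mxE; apply: cvg_big => [|k _]; first exact: add_continuous.
by apply: cvgM; exact: cvg_mx_entry.
Qed.

(** Write [W] as [invmx A0] applied to [A *m W + (A0 - A) *m W]; for [A] close to [A0] the second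
    term costs at most half of [|W|] and is absorbed on the left. The neighbourhood does not depend
    on [s], so [W] may be a column, a kernel or an inverse. *)
Lemma near_unitmx_inj {R : realType} {N} (A0 : 'M[R]_N) : A0 \in unitmx ->
  exists2 c : R, 0 < c & \forall A \near A0,
    forall s (W : 'M[R]_(N, s)), `|W| <= c * `|A *m W|.
Proof.
move=> A0u; pose K : R := N%:R * `|invmx A0| + 1.
have K0 : 0 < K by rewrite ltr_wpDl// mulr_ge0.
(* Chosen so that [K * (N%:R * e) <= 1/2]; the added 1s keep [K] and the denominator positive. *)
pose e : R := (2 * K * (N%:R + 1))^-1.
have e0 : 0 < e by rewrite invr_gt0 !mulr_gt0// ltr_wpDl.
exists (2 * K); first by rewrite mulr_gt0.
near=> A => s W.
have Ae : `|A0 - A| <= e.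
  by near: A; move/cvgrPdist_le : (@cvg_id _ (nbhs A0)); exact.
have le_W : `|W| <= K * (`|A *m W| + N%:R * e * `|W|).
  have {1}-> : W = invmx A0 *m (A *m W + (A0 - A) *m W).
    by rewrite -mulmxDl addrC subrK mulKmx.
  apply: (le_trans (mx_norm_mulmx _ _)).
  apply: ler_pM => //; first by rewrite lerDl.
  rewrite (le_trans (ler_normD _ _))// lerD2l.
  by rewrite (le_trans (mx_norm_mulmx _ _))// ler_wpM2r// ler_wpM2l.
have KNe : K * (N%:R * e) <= 2^-1.
  rewrite mulrA ler_pdivrMr ?mulr_gt0// ?ltr_wpDl// !mulrA mulVf// mul1r.
  by rewrite ler_pM2l// lerDl.
have := ler_wpM2r (normr_ge0 W) KNe.
move: le_W; rewrite mulrDr !mulrA; lra.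
Unshelve. all: by end_near. Qed.

Lemma near_unitmx {R : realType} {N} (A0 : 'M[R]_N) : A0 \in unitmx ->
  \forall A \near A0, A \in unitmx.
Proof.
move=> /near_unitmx_inj[c c0]; apply: filterS => A Ainj.
(* [kermx] is a left kernel whereas the lower bound concerns [A *m W], hence the transposes. *)
rewrite -unitmx_tr -row_free_unit -kermx_eq0 -normr_le0 -[kermx _]trmxK.
suff -> : (kermx A^T)^T = 0 by rewrite trmx0 normr0.
apply/eqP; rewrite -normr_le0 (le_trans (Ainj _ _))//.
by rewrite -[X in X *m _]trmxK -trmx_mul mulmx_ker trmx0 normr0 mulr0.
Qed.

Lemma cvg_invmx {R : realType} {T : Type} {N} (F : set_system T) {FF : Filter F}
    (A : T -> 'M[R]_N) (A0 : 'M[R]_N) : A0 \in unitmx ->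
  A x @[x --> F] --> A0 -> invmx (A x) @[x --> F] --> invmx A0.
Proof.
move=> A0u cA; have [c c0 inj_near] := near_unitmx_inj A0 A0u.
apply/cvgrPdist_le => e e0; pose k := c * (N%:R * `|invmx A0| + 1).
have k0 : 0 < k by rewrite mulr_gt0// ltr_wpDl// mulr_ge0.
near=> x.
have Axu : A x \in unitmx by near: x; exact: cA (near_unitmx A0 A0u).
have le_cAx : forall s (W : 'M[R]_(N, s)), `|W| <= c * `|A x *m W|.
  by near: x; exact: cA inj_near.
have AxA0 : `|A0 - A x| <= e / k.
  by near: x; move/cvgrPdist_le : cA; apply; rewrite divr_gt0.
(* Multiplying the difference of inverses by [A x] leaves [(A x - A0) *m invmx A0], which is
   small. *)
rewrite (le_trans (le_cAx _ _))// mulmxBr mulmxV//.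
rewrite -(mulmxV A0u) -mulmxBl -opprB mulNmx normrN.
rewrite (le_trans (ler_wpM2l (ltW c0) (mx_norm_mulmx _ _)))//.
move: AxA0; rewrite ler_pdivlMr//; apply: le_trans.
by rewrite /k [leRHS]mulrCA ler_pM2l// [leRHS]mulrC mulrAC ler_wpM2r// lerDl.
Unshelve. all: by end_near. Qed.

Lemma mulmx_trmx_eq0 {R : realDomainType} {p q} (A : 'M[R]_(p, q)) :
  A *m A^T = 0 -> A = 0.
Proof.
move=> AAT; apply/matrixP => i j; rewrite mxE.
have /eqP := congr1 (fun B : 'M[R]_p => B i i) AAT; rewrite !mxE.
under eq_bigr do rewrite mxE -expr2.
rewrite psumr_eq0 => [/allP/(_ j (mem_index_enum j))|k _]; last exact: sqr_ge0.
by rewrite sqrf_eq0 => /eqP.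
Qed.

(** If [K] is the left kernel of [A *m A^T], then [K *m A] times its own transpose vanishes, so
    [K *m A = 0], and row freeness gives [K = 0]. *)
Lemma gram_unitmx {R : realFieldType} {p q} (A : 'M[R]_(p, q)) :
  row_free A -> A *m A^T \in unitmx.
Proof.
move=> Afree; rewrite -row_free_unit -kermx_eq0; set K := kermx _.
have : (K *m A) *m (K *m A)^T = 0.
  by rewrite trmx_mul !mulmxA -(mulmxA K A A^T) mulmx_ker mul0mx.
by move/mulmx_trmx_eq0/eqP; rewrite mulmx_free_eq0.
Qed.

(** * Jacobi matrices and first-order expansion *)

Lemma diff_jac {R : realType} {n p} (h : 'cV[R]_n -> 'cV[R]_p) x u :
  differentiable h x -> 'd h x u = jac h x *m u.
Proof.
move=> dh; rewrite {1}[u]matrix_sum_delta linear_sum/=.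
apply/matrixP => i k; rewrite (ord1 k) !mxE summxE.
apply: eq_bigr => j _; rewrite big_ord1 linearZ/= !mxE -deriveE//.
by rewrite derive_mx ?mxE 1?mulrC//; exact: diff_derivable.
Qed.

Lemma near_jac {R : realType} {n p} (h : 'cV[R]_n -> 'cV[R]_p) x0 :
  differentiable h x0 -> forall e : R, 0 < e -> \forall x \near x0,
    `|h x - h x0 - jac h x0 *m (x - x0)| <= e * `|x - x0|.
Proof.
move=> dh e e0; near=> x.
(* [diffE] expands around the limit of the filter [nbhs x0], which is [x0] because the space is
   Hausdorff. *)
rewrite -diff_jac// (diffE dh x) /= lim_id; last exact: norm_hausdorff.
rewrite -addrA -opprD addrAC subrr add0r.
near: x; exact: littleoP.
Unshelve. all: by end_near. Qed.

Lemma differentiable_mx {R : realType} {V : normedModType R} {p q}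
    (h : V -> 'M[R]_(p, q)) x :
  (forall i j, differentiable (fun y => h y i j : R) x) -> differentiable h x.
Proof.
move=> dh.
have -> : h = \sum_(i < p) \sum_(j < q) (fun y => h y i j *: delta_mx i j).
  apply/funext => y; rewrite {1}[h y]matrix_sum_delta fct_sumE.
  by apply: eq_bigr => i _; rewrite fct_sumE.
apply: differentiable_sum => i; apply: differentiable_sum => j.
exact: differentiableZl.
Qed.

Lemma mx_norm_col {R : realType} {p1 p2 q}
    (A : 'M[R]_(p1, q)) (B : 'M[R]_(p2, q)) :
  `|col_mx A B| = Num.max `|A| `|B|.
Proof.
apply/eqP; rewrite eq_le; apply/andP; split.
  apply: mx_norm_le => [|i j]; first by rewrite le_max normr_ge0.
  by rewrite mxE le_max; case: fintype.split => k; rewrite le_mx_entry ?orbT.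
rewrite ge_max; apply/andP; split; apply: mx_norm_le => // i j.
  by rewrite -(col_mxEu A B) le_mx_entry.
by rewrite -(col_mxEd A B) le_mx_entry.
Qed.

(** * Euclidean distance to a set *)

Lemma edist_to_le {R : realType} {n} (Q : set 'cV[R]_n) x y :
  Q y -> edist_to Q x <= enorm (x - y).
Proof.
move=> Qy; apply: ge_inf; last by exists y.
by exists 0 => _ [z _ <-]; exact: sqrtr_ge0.
Qed.

Lemma edist_to_set0 {R : realType} {n} (x : 'cV[R]_n) : edist_to set0 x = 0.
Proof. by rewrite /edist_to image_set0 inf0. Qed.

Lemma edist_to_ge0 {R : realType} {n} (Q : set 'cV[R]_n) x : 0 <= edist_to Q x.
Proof.
have [->|/set0P[y Qy]] := eqVneq Q set0; first by rewrite edist_to_set0.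
apply: lb_le_inf; first by exists (enorm (x - y)); exists y.
by move=> _ [z _ <-]; exact: sqrtr_ge0.
Qed.

(** * Smoothness of the constraints and of the Lagrangian gradient *)

Lemma differentiable_coordf {R : realType} {n m} (g : 'cV[R]_n -> 'cV[R]_m) x :
  (forall i, differentiable (coordf g i) x) -> differentiable g x.
Proof.
by move=> dg; apply: differentiable_mx => i j; rewrite (ord1 j); exact: dg.
Qed.

Lemma cvg_jac {R : realType} {n m} (g : 'cV[R]_n -> 'cV[R]_m) x0 :
  (forall i, twice_cont_differentiable (coordf g i)) ->
  {for x0, continuous (jac g)}.
Proof.
move=> gC2; apply: (cvg_mx (nbhs x0)) => i j.
have jacE x : jac g x i j = grad (coordf g i) x j 0 by rewrite !mxE.
rewrite jacE; under eq_fun do rewrite jacE; apply: (cvg_mx_entry (nbhs x0)).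
have [_ dgrad _] := gC2 i.
exact: differentiable_continuous (dgrad x0).
Qed.

(** The multiplier comes before the point, so that fixing [l] yields the map of [x] whose Jacobi
    matrix is the upper left block of [lagrange_jac]. *)
Definition lagrange_grad {R : realType} {n m} (f : 'cV[R]_n -> R)
    (g : 'cV[R]_n -> 'cV[R]_m) (l : 'cV[R]_m) (x : 'cV[R]_n) : 'cV[R]_n :=
  grad f x + (jac g x)^T *m l.

Lemma lagrange_gradE {R : realType} {n m} (f : 'cV[R]_n -> R)
    (g : 'cV[R]_n -> 'cV[R]_m) (l : 'cV[R]_m) :
  lagrange_grad f g l = grad f + \sum_(i < m) l i 0 *: grad (coordf g i).
Proof.
apply/funext => x; apply/matrixP => j k; rewrite (ord1 k) /lagrange_grad.
rewrite -[RHS]/((grad f x + _ x) j 0) fct_sumE !mxE summxE; congr (_ + _).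
by apply: eq_bigr => i _; rewrite !mxE mulrC.
Qed.

Lemma differentiable_lagrange_grad {R : realType} {n m} (f : 'cV[R]_n -> R)
    (g : 'cV[R]_n -> 'cV[R]_m) (l : 'cV[R]_m) x :
  twice_cont_differentiable f ->
  (forall i, twice_cont_differentiable (coordf g i)) ->
  differentiable (lagrange_grad f g l) x.
Proof.
move=> [_ df _] gC2; rewrite lagrange_gradE; apply: differentiableD => //.
apply: differentiable_sum => i; apply: differentiableZ.
by have [_ dg _] := gC2 i.
Qed.

Lemma jac_derive {R : realType} {n p} (h : 'cV[R]_n -> 'cV[R]_p) x i j :
  differentiable h x -> jac h x i j = ('D_(delta_mx j 0) h x) i 0.
Proof. by move=> dh; rewrite derive_mx ?mxE//; exact: diff_derivable. Qed.

Lemma jac_lagrange_grad {R : realType} {n m} (f : 'cV[R]_n -> R)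
    (g : 'cV[R]_n -> 'cV[R]_m) (l : 'cV[R]_m) x :
  twice_cont_differentiable f ->
  (forall i, twice_cont_differentiable (coordf g i)) ->
  jac (lagrange_grad f g l) x =
    hess f x + \sum_(i < m) l i 0 *: hess (coordf g i) x.
Proof.
move=> fC2 gC2; have [_ df _] := fC2.
have dg i : differentiable (grad (coordf g i)) x by have [_ dg _] := gC2 i.
have dZ i v : derivable (l i 0 *: grad (coordf g i)) x v.
  by apply: diff_derivable; exact: differentiableZ.
apply/matrixP => j k; rewrite jac_derive; last first.
  exact: differentiable_lagrange_grad.
rewrite lagrange_gradE deriveD; last 2 first.
- exact: diff_derivable.
- exact: derivable_sum.
rewrite derive_sum// !mxE !summxE; congr (_ + _).
  by rewrite -jac_derive// mxE.
apply: eq_bigr => i _; rewrite deriveZ; last exact: diff_derivable.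
by rewrite !mxE -jac_derive// mxE.
Qed.

(** * Projected gradient and local error bounds *)

Lemma tangent_proj_grad {R : realType} {n m} (f : 'cV[R]_n -> R)
    (g : 'cV[R]_n -> 'cV[R]_m) x :
  tangent_proj g x *m grad f x = lagrange_grad f g (multiplier f g x) x.
Proof.
rewrite /tangent_proj mulmxBl mul1mx.
by rewrite /lagrange_grad /multiplier mulmxN !mulmxA.
Qed.

Lemma near_stationary {R : realType} {n m} (f : 'cV[R]_n -> R)
    (g : 'cV[R]_n -> 'cV[R]_m) x0 :
  twice_cont_differentiable f ->
  (forall i, twice_cont_differentiable (coordf g i)) ->
  stationary f g x0 -> lagrange_jac f g x0 (multiplier f g x0) \in unitmx ->
  exists2 c : R, 0 < c & \forall x \near x0,
    feasible g x -> `|x - x0| <= c * `|tangent_proj g x *m grad f x|.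
Proof.
move=> fC2 gC2 [gx0 phi0] /near_unitmx_inj[c c0 inj_near].
pose l0 := multiplier f g x0; pose H := jac (lagrange_grad f g l0) x0.
(* Only the upper right block varies with [x]; this makes the identity for the upper component below
   exact. *)
pose A x := block_mx H (jac g x)^T (jac g x0) 0.
have cA : A x @[x --> x0] --> lagrange_jac f g x0 l0.
  rewrite /lagrange_jac -jac_lagrange_grad// -/H.
  apply: (cvg_mx (nbhs x0)) => i j; rewrite /A /block_mx.
  under eq_fun do rewrite mxE; rewrite mxE.
  case: fintype.split => k.
    under eq_fun do rewrite mxE; rewrite mxE.
    case: fintype.split => k'; first exact: cvg_cst.
    under eq_fun do rewrite mxE; rewrite mxE.
    by apply: (cvg_mx_entry (nbhs x0)); exact: cvg_jac.
  by exact: cvg_cst.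
(* Linearization errors are kept below [(2 * c)^-1 * |x - x0|]; after multiplication by [c] they
   amount to half of [|x - x0|] and are absorbed. *)
exists (2 * c); first by rewrite mulr_gt0.
have e0 : 0 < (2 * c)^-1 by rewrite invr_gt0 mulr_gt0.
have dg : differentiable g x0.
  by apply: differentiable_coordf => i; have [dgi _ _] := gC2 i.
near=> x => gx.
have le_cA : forall s (W : 'M[R]_(n + m, s)), `|W| <= c * `|A x *m W|.
  by near: x; exact: cA inj_near.
have : `|g x - g x0 - jac g x0 *m (x - x0)| <= (2 * c)^-1 * `|x - x0|.
  by near: x; exact: near_jac.
have : `|lagrange_grad f g l0 x - lagrange_grad f g l0 x0 - H *m (x - x0)|
    <= (2 * c)^-1 * `|x - x0|.
  by near: x; apply: near_jac e0; exact: differentiable_lagrange_grad.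
set u := x - x0 => lin_h lin_g; pose w := multiplier f g x - l0.
rewrite tangent_proj_grad; set phi := lagrange_grad _ _ _ _.
have Axuw : `|A x *m col_mx u w| <= `|phi| + (2 * c)^-1 * `|u|.
  rewrite mul_block_col mul0mx addr0 mx_norm_col ge_max; apply/andP; split.
    (* Replacing [l0] by the multiplier at [x] changes the Lagrangian gradient at [x] by exactly
       [(jac g x)^T *m w], and the gradient for [l0] vanishes at [x0]. *)
    have -> : H *m u + (jac g x)^T *m w =
        phi - (lagrange_grad f g l0 x - lagrange_grad f g l0 x0 - H *m u).
      rewrite -[lagrange_grad f g l0 x0]tangent_proj_grad phi0 subr0.
      rewrite opprB addrCA; congr (_ + _).
      rewrite /phi /lagrange_grad opprD addrACA subrr add0r.
      by rewrite -mulmxBr.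
    by rewrite (le_trans (ler_normB _ _))// lerD2l.
  (* Both points are feasible, so [jac g x0 *m u] is the linearization error of [g] up to sign. *)
  move: lin_g; rewrite gx gx0 subrr sub0r normrN => /le_trans; apply.
  by rewrite lerDr.
have u_le : `|u| <= c * (`|phi| + (2 * c)^-1 * `|u|).
  apply: le_trans (le_trans (le_cA _ (col_mx u w)) (ler_wpM2l (ltW c0) Axuw)).
  by rewrite mx_norm_col le_max lexx.
have ce : c * (2 * c)^-1 = 2^-1 by rewrite invfM mulrCA mulfV ?mulr1// gt_eqF.
move: u_le; rewrite mulrDr mulrA ce; lra.
Unshelve. all: by end_near. Qed.

(** Full rank at [x0] makes the Gram matrix invertible there, so [invmx] is continuous at it. *)
Lemma cvg_tangent_proj_grad {R : realType} {n m} (f : 'cV[R]_n -> R)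
    (g : 'cV[R]_n -> 'cV[R]_m) x0 :
  twice_cont_differentiable f ->
  (forall i, twice_cont_differentiable (coordf g i)) ->
  \rank (jac g x0) = m ->
  {for x0, continuous (fun x => tangent_proj g x *m grad f x)}.
Proof.
move=> [_ df _] gC2 rk.
have cJ : jac g x @[x --> x0] --> jac g x0 by exact: cvg_jac.
have cJT : (jac g x)^T @[x --> x0] --> (jac g x0)^T.
  apply: (cvg_mx (nbhs x0)) => i j; under eq_fun do rewrite mxE.
  by rewrite mxE; exact: (cvg_mx_entry (nbhs x0)).
apply: (cvg_mulmx (nbhs x0)); last exact: differentiable_continuous.
apply: cvgB; first exact: cvg_cst.
apply: (cvg_mulmx (nbhs x0)) => //; apply: (cvg_mulmx (nbhs x0)) => //.
apply: (cvg_invmx (nbhs x0)); last exact: (cvg_mulmx (nbhs x0)).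
by apply: gram_unitmx; rewrite /row_free rk.
Qed.

Lemma near_error_bound {R : realType} {n m} (f : 'cV[R]_n -> R)
    (g : 'cV[R]_n -> 'cV[R]_m) x0 :
  twice_cont_differentiable f ->
  (forall i, twice_cont_differentiable (coordf g i)) ->
  feasible g x0 -> \rank (jac g x0) = m ->
  (stationary f g x0 -> lagrange_jac f g x0 (multiplier f g x0) \in unitmx) ->
  exists2 mu : R, 0 < mu & \forall x \near x0, feasible g x ->
    mu * edist_to (stationary f g) x <= enorm (tangent_proj g x *m grad f x).
Proof.
move=> fC2 gC2 gx0 rk nondeg.
have [phi0|phi0] := eqVneq (tangent_proj g x0 *m grad f x0) 0.
  have stx0 : stationary f g x0 by [].
  have [c c0 near_c] := near_stationary f g x0 fC2 gC2 stx0 (nondeg stx0).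
  (* The factor [n] converts the sup norm of [x - x0] to the Euclidean one; the 1 ensures
     positivity. *)
  exists ((n%:R + 1) * c)^-1; first by rewrite invr_gt0 mulr_gt0// ltr_wpDl.
  apply: filterS near_c => x near_c gx.
  rewrite ler_pdivrMl; last by rewrite mulr_gt0// ltr_wpDl.
  rewrite (le_trans (edist_to_le _ x _ stx0))// (le_trans (enorm_le_norm _))//.
  rewrite -mulrA; apply: ler_pM => //; first by rewrite lerDl.
  by rewrite (le_trans (near_c gx))// ler_pM2l// enorm_ge_norm.
(* Without stationary points the distance takes the default value 0 and any constant works;
   otherwise a fixed stationary [y] bounds it near [x0]. *)
have [->|/set0P[y sty]] := eqVneq (stationary f g) set0.
  exists 1 => //; apply: filterE => x _.
  by rewrite edist_to_set0 mulr0 sqrtr_ge0.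
set a := `|tangent_proj g x0 *m grad f x0|.
have a0 : 0 < a by rewrite normr_gt0.
(* Bounds the Euclidean distance to [y] on the unit sup-norm ball around [x0]; the last 1 ensures
   positivity. *)
pose D : R := n%:R * (1 + `|x0 - y|) + 1.
have D0 : 0 < D by rewrite ltr_wpDl// mulr_ge0// addr_ge0.
exists (a / 2 / D); first by rewrite !divr_gt0.
near=> x => gx.
have le_phi : a / 2 <= enorm (tangent_proj g x *m grad f x).
  apply: le_trans (enorm_ge_norm _).
  have : `|tangent_proj g x0 *m grad f x0 - tangent_proj g x *m grad f x|
      <= a / 2.
    near: x; move/cvgrPdist_le : (cvg_tangent_proj_grad f g x0 fC2 gC2 rk).
    by apply; rewrite divr_gt0.
  have := lerB_normD (tangent_proj g x0 *m grad f x0)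
    (- (tangent_proj g x *m grad f x)).
  rewrite normrN -/a; lra.
apply: le_trans le_phi; rewrite mulrAC ler_pdivrMr// ler_pM2l ?divr_gt0//.
rewrite (le_trans (edist_to_le _ x _ sty))// (le_trans (enorm_le_norm _))//.
rewrite /D ler_wpDr// ler_wpM2l//.
rewrite -[x](subrK x0) -addrA (le_trans (ler_normD _ _))// lerD2r distrC.
near: x; move/cvgrPdist_le : (@cvg_id _ (nbhs x0)); exact.
Unshelve. all: by end_near. Qed.

Theorem theorem2 (R : realType) (n m : nat) (hmn : (m < n)%N)
    (f : 'cV[R]_n -> R) (g : 'cV[R]_n -> 'cV[R]_m)
    (L0 L1 : R) (r : R)
    (f_C2 : twice_cont_differentiable f)
    (g_C2 : forall i : 'I_m, twice_cont_differentiable (coordf g i))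
    (hess_f_lip : exists L : R, elipschitz opnorm L (hess f))
    (hess_g_lip : forall i : 'I_m,
       exists L : R, elipschitz opnorm L (hess (coordf g i)))
    (f_lip : elipschitz (fun t : R => `|t|) L0 f)
    (grad_f_lip : elipschitz enorm L1 (grad f))
    (S_nonempty : feasible g !=set0)
    (S_compact : compact (feasible g))
    (S_manifold : manifold_without_boundary (n - m) (feasible g))
    (g_rank : forall x, feasible g x -> \rank (jac g x) = m)
    (r_gt0 : 0 < r)
    (S_prox : proximally_smooth (feasible g) r)
    (nondeg : nondegenerate_problem f g) :
  exists2 mu : R, 0 < mu &
    forall x, feasible g x ->
      mu * edist_to (stationary f g) x <= enorm (tangent_proj g x *m grad f x).
Proof.
(* Feasibility is part of [P] because the covering argument ranges over full neighbourhoods in the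
   ambient space. *)
pose P mu x := feasible g x ->
  mu * edist_to (stationary f g) x <= enorm (tangent_proj g x *m grad f x).
have near_P : \forall mu \near 0^'+, feasible g `<=` P mu.
  (* Near-covering compactness replaces the minimum over a finite subcover: a bound valid for [x]
     near each [x0] and all small [mu > 0] holds on the whole set for all small [mu > 0]. *)
  move/compact_near_coveringP : S_compact; apply => x0 gx0.
  have [mu0 mu0_gt0 near_x0] := near_error_bound f g x0 f_C2 g_C2 gx0
    (g_rank x0 gx0) (nondeg.1 x0).
  near=> x mu.
  have le_mu : mu <= mu0 by near: mu; exact: nbhs_right_le.
  have : feasible g x -> mu0 * edist_to (stationary f g) x <=
    enorm (tangent_proj g x *m grad f x) by near: x.
  (* Distances are nonnegative, so decreasing the constant preserves the bound. *)
  by move=> + gx => /(_ gx); apply: le_trans; rewrite ler_wpM2r ?edist_to_ge0.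
near (0 : R)^'+ => mu; exists mu; first by near: mu; exact: nbhs_right_gt.
have Pmu : feasible g `<=` P mu by near: mu.
by move=> x gx; exact: Pmu.
Unshelve. all: by end_near. Qed.
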